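(* Assume P1: there is $\delta_0>0$ such that $\int_{\mathbb G} N(g)^{\delta_0}\,\boldsymbol\mu(\mathrm dg)<+\infty$. Let $\mathscr B$ be the Banach space built from $\delta_0$ in the context. Then: 1. The constant function $e\equiv 1$ on $\mathbb X$ belongs to $\mathscr B$. 2. For every $x\in\mathbb X$, the Dirac measure $\boldsymbol\delta_x: h\mapsto h(x)$ belongs to the dual $\mathscr B'$ of $\mathscr B$. 3. For every $x\in\mathbb X$, $\mathscr B$ is included in $L^1(\mathbf P(x,\cdot))$. 4. There exists a constant $\kappa\in(0,1)$ such that for every $h\in\mathscr B$ and every real $t$ with $|t|\le\kappa$, the function $\mathrm e^{\mathrm it\rho}h$ belongs to $\mathscr B$.
   Context: Let $d\ge 1$ and $\mathbb G=\mathrm{GL}_d(\mathbb R)$. $\mathbb R^d$ carries the Euclidean norm $\|\cdot\|$ and $\mathbb G$ the associated operator norm $\|g\|$. $\mathbb P(\mathbb R^d)$ is the projective space; $\overline v$ is the direction of $v\in\mathbb R^d\setminus\{0\}$; $d(\overline u,\overline v)=\|u\wedge v\|/(\|u\|\|v\|)$, where $\|u\wedge v\|^2=\|u\|^2\|v\|^2-\langle u,v\rangle^2$; $g\cdot\overline v=\overline{gv}$. Put $N(g)=\max(\|g\|,\|g^{-1}\|)$. $\boldsymbol\mu$ is a Borel probability measure on $\mathbb G$. Let $\mathbb X=\mathbb G\times\mathbb P(\mathbb R^d)$ and $\rho(g,\overline v)=\log(\|gv\|/\|v\|)$ for $(g,\overline v)\in\mathbb X$. The Markov kernel $\mathbf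 P$ on $\mathbb X$ is given by $\mathbf Ph(g,\overline u)=\int_{\mathbb G}h(g_1,g\cdot\overline u)\,\boldsymbol\mu(\mathrm dg_1)$, i.e. $\mathbf P((g,\overline u),\cdot)$ is the law of $(g_1,g\cdot\overline u)$ with $g_1\sim\boldsymbol\mu$. With $\delta_0>0$ the constant of P1, put $\varepsilon=\delta_0/8$, $\theta=3\varepsilon$, $\alpha=5\varepsilon$, $\beta=7\varepsilon$. $\mathscr C(\mathbb X,\mathbb C)$ is the set of continuous functions $\mathbb X\to\mathbb C$. For $h\in\mathscr C(\mathbb X,\mathbb C)$ let $$|h|_\theta=\sup_{(g,\overline u)\in\mathbb X}\frac{|h(g,\overline u)|}{N(g)^\theta},\quad k_{\varepsilon,\alpha}(h)=\sup_{g\in\mathbb G,\ \overline u\ne\overline v}\frac{|h(g,\overline u)-h(g,\overline v)|}{d(\overline u,\overline v)^\varepsilon N(g)^\alpha},\quad k'_{\varepsilon,\beta}(h)=\sup_{g\neq g',\ \overline u}\frac{|h(g,\overline u)-h(g',\overline u)|}{\|g-g'\|^\varepsilon N(g)^\beta N(g')^\beta},$$ $\|h\|_{\mathscr B}=|h|_\theta+k_{\varepsilon,\alpha}(h)+k'_{\varepsilon,\beta}(h)$, and $\mathscr B=\{h\in\mathscr C(\mathbb X,\mathbb C):\|h\|_{\mathscr B}<+\infty\}$ with norm $\|\cdot\|_{\mathscr B}$.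
   Formalization: Item 4 is stated under the extra assumption δ₀ ≤ 8 (so ε = δ₀/8 ≤ 1); for δ₀ > 8 it is false, since with h = 1 and t = κ ≠ 0 the function e^{itρ} is not Hölder of exponent ε > 1. Items 1–3 hold for every δ₀ > 0. *)

(* Defs.v *)
From HB Require Import structures.
From mathcomp Require Import all_boot all_order all_algebra.
From mathcomp Require Import all_classical all_reals all_analysis.
From mathcomp Require Import measurable_realfun complex ring lra.

Set Implicit Arguments.
Unset Strict Implicit.
Unset Printing Implicit Defensive.

Import Order.TTheory GRing.Theory Num.Theory numFieldNormedType.Exports.
Import ComplexField.

Local Open Scope classical_set_scope.
Local Open Scope ring_scope.
Local Open Scope complex_scope.

HB.instance Definition _ (T U : ptopologicalType) := Pointed.on (T * U)%type.

Notation borel T := (g_sigma_algebraType (@open T)).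

Lemma continuous_borel_measurable (T U : ptopologicalType) (f : T -> U) :
  continuous f -> measurable_fun setT (f : borel T -> borel U).
Proof.
move=> cf.
apply: (@measurability _ _ (borel T) (borel U) setT f (@open U)) => //.
move=> _ [A oA <-]; rewrite setTI; apply: sub_sigma_algebra.
by apply: open_comp => // x _; exact: cf.
Qed.

Section Euclidean.
Context {R : realType}.

Lemma sum_CauchySchwarz (I : finType) (a b : I -> R) :
  (\sum_i a i * b i) ^+ 2 <= (\sum_i a i ^+ 2) * (\sum_i b i ^+ 2).
Proof.
have : 0 <= \sum_i \sum_j (a i * b j - a j * b i) ^+ 2.
  by apply: sumr_ge0 => i _; apply: sumr_ge0 => j _; exact: sqr_ge0.
have -> : \sum_i \sum_j (a i * b j - a j * b i) ^+ 2 =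
    \sum_i \sum_j (a i ^+ 2 * b j ^+ 2) + \sum_i \sum_j (b i ^+ 2 * a j ^+ 2)
    - 2 * \sum_i \sum_j ((a i * b i) * (a j * b j)).
  rewrite mulr_sumr -big_split -sumrB /=; apply: eq_bigr => i _.
  rewrite mulr_sumr -big_split -sumrB /=; apply: eq_bigr => j _; ring.
rewrite -!big_distrlr /=; nra.
Qed.

Lemma sum_Minkowski (I : finType) (a b : I -> R) :
  Num.sqrt (\sum_i (a i + b i) ^+ 2) <=
  Num.sqrt (\sum_i a i ^+ 2) + Num.sqrt (\sum_i b i ^+ 2).
Proof.
have A0 : 0 <= \sum_i a i ^+ 2 by apply: sumr_ge0 => i _; exact: sqr_ge0.
have B0 : 0 <= \sum_i b i ^+ 2 by apply: sumr_ge0 => i _; exact: sqr_ge0.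
rewrite -(@ler_pXn2r _ 2) ?nnegrE ?addr_ge0 ?sqrtr_ge0//.
rewrite sqr_sqrtr; last by apply: sumr_ge0 => i _; exact: sqr_ge0.
rewrite sqrrD !sqr_sqrtr//.
have -> : \sum_i (a i + b i) ^+ 2 =
    \sum_i a i ^+ 2 + (\sum_i a i * b i) *+ 2 + \sum_i b i ^+ 2.
  by rewrite -sumrMnl -!big_split /=; apply: eq_bigr => i _; rewrite sqrrD.
rewrite lerD2r lerD2l lerMn2r /= -sqrtrM//.
by apply: le_trans (ler_norm _) _; rewrite -sqrtr_sqr ler_sqrt// ?mulr_ge0//
  sum_CauchySchwarz.
Qed.

Context {n : nat}.
Implicit Types (u v w : 'cV[R]_n.+1) (g : 'M[R]_n.+1) (c : R).

Definition dotv u v : R := \sum_i u i ord0 * v i ord0.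

Definition enorm v : R := Num.sqrt (dotv v v).

Definition wedge_norm u v : R :=
  Num.sqrt (enorm u ^+ 2 * enorm v ^+ 2 - dotv u v ^+ 2).

Definition opnorm g : R := sup [set enorm (g *m v) | v in [set v | enorm v = 1]].

Lemma dotvC u v : dotv u v = dotv v u.
Proof. by apply: eq_bigr => i _; rewrite mulrC. Qed.

Lemma dotvZl c u v : dotv (c *: u) v = c * dotv u v.
Proof. by rewrite mulr_sumr; apply: eq_bigr => i _; rewrite mxE mulrA. Qed.

Lemma dotvZr c u v : dotv u (c *: v) = c * dotv u v.
Proof. by rewrite dotvC dotvZl dotvC. Qed.

Lemma dotvBl u v w : dotv (u - v) w = dotv u w - dotv v w.
Proof. by rewrite -sumrB; apply: eq_bigr => i _; rewrite !mxE mulrBl. Qed.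

Lemma dotvBr u v w : dotv w (u - v) = dotv w u - dotv w v.
Proof. by rewrite !(dotvC w) dotvBl. Qed.

Lemma dotvv_ge0 v : 0 <= dotv v v.
Proof. by apply: sumr_ge0 => i _; rewrite -expr2 sqr_ge0. Qed.

Lemma dotvv_eq0 v : (dotv v v == 0) = (v == 0).
Proof.
apply/eqP/eqP => [/eqP|->]; last by apply: big1 => i _; rewrite mxE mul0r.
rewrite psumr_eq0 => [/allP v0|i _]; last by rewrite -expr2 sqr_ge0.
apply/colP => i; rewrite mxE; have := v0 i.
by rewrite mem_index_enum -expr2 sqrf_eq0 => /(_ isT)/eqP.
Qed.

Lemma enorm2 v : enorm v ^+ 2 = dotv v v.
Proof. by rewrite sqr_sqrtr ?dotvv_ge0. Qed.

Lemma enorm_gt0 v : (0 < enorm v) = (v != 0).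
Proof. by rewrite sqrtr_gt0 lt_neqAle eq_sym dotvv_eq0 dotvv_ge0 andbT. Qed.

Lemma enormZ c v : enorm (c *: v) = `|c| * enorm v.
Proof.
by rewrite /enorm dotvZl dotvZr mulrA -expr2 sqrtrM ?sqr_ge0// sqrtr_sqr.
Qed.

Lemma enorm_mulmx g v :
  enorm (g *m v) <= Num.sqrt (\sum_i \sum_j g i j ^+ 2) * enorm v.
Proof.
have G0 : 0 <= \sum_i \sum_j g i j ^+ 2.
  by apply: sumr_ge0 => i _; apply: sumr_ge0 => j _; exact: sqr_ge0.
rewrite /enorm -sqrtrM// ler_sqrt ?mulr_ge0 ?dotvv_ge0// mulr_suml.
apply: ler_sum => i _; rewrite -expr2 mxE.
apply: le_trans (sum_CauchySchwarz _ _) _.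
apply: ler_wpM2l; first by apply: sumr_ge0 => j _; exact: sqr_ge0.
by apply: ler_sum => j _; rewrite expr2.
Qed.

Lemma enorm_opnorm g v : enorm (g *m v) <= opnorm g * enorm v.
Proof.
have [->|v0] := eqVneq v 0.
  by rewrite mulmx0 -(scale0r (0 : 'cV[R]_n.+1)) enormZ normr0 !mul0r mulr0.
have ev : 0 < enorm v by rewrite enorm_gt0.
rewrite -ler_pdivrMr//; apply: ub_le_sup.
  exists (Num.sqrt (\sum_i \sum_j g i j ^+ 2)) => _ [w /= w1 <-].
  by apply: le_trans (enorm_mulmx g w) _; rewrite w1 mulr1.
exists ((enorm v)^-1 *: v) => /=.
  by rewrite enormZ ger0_norm ?invr_ge0 ?ltW// mulVf ?gt_eqF.
by rewrite -scalemxAr enormZ ger0_norm ?invr_ge0 ?ltW// mulrC.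
Qed.

Lemma wedge_norm_ge0 u v : 0 <= enorm u ^+ 2 * enorm v ^+ 2 - dotv u v ^+ 2.
Proof.
rewrite subr_ge0 !enorm2 (le_trans (sum_CauchySchwarz _ _))//.
Qed.

Lemma wedge_normC u v : wedge_norm u v = wedge_norm v u.
Proof. by rewrite /wedge_norm dotvC [X in X - _]mulrC. Qed.

Lemma wedge_normZl c u v : wedge_norm (c *: u) v = `|c| * wedge_norm u v.
Proof.
rewrite /wedge_norm enormZ dotvZl !exprMn real_normK ?num_real//.
by rewrite -mulrA -mulrBr sqrtrM ?sqr_ge0// sqrtr_sqr.
Qed.

Lemma wedge_normZr c u v : wedge_norm u (c *: v) = `|c| * wedge_norm u v.
Proof. by rewrite wedge_normC wedge_normZl wedge_normC. Qed.

End Euclidean.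

Section Spaces.
Variables (R : realType) (n : nat).
Implicit Types (u v w : 'cV[R]_n.+1).

(* The dimension of the vector space is n.+1; GL carries the topology induced by matrices. *)
Definition GL : Type := set_type [set g : 'M[R]_n.+1 | g \in unitmx].

HB.instance Definition _ := Topological.on GL.

Definition GLmx (g : GL) : 'M[R]_n.+1 := set_val g.

Lemma GLmx_unit (g : GL) : GLmx g \in unitmx.
Proof. exact: (set_valP g). Qed.

Definition GL1 : GL := 
  exist _ 1%:M (mem_set (unitmx1 R n.+1 : [set g | g \in unitmx] 1%:M)).

HB.instance Definition _ := isPointed.Build GL GL1.

Lemma GLmx_neq0 (g : GL) v : v != 0 -> GLmx g *m v != 0.
Proof.
apply: contra_neq => gv0.
by rewrite -[v](mulKmx (GLmx_unit g)) gv0 mulmx0.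
Qed.

(* A point of the projective space is a line, i.e. a 1-dimensional subspace. *)
Record proj := Proj {
  line : {vspace 'cV[R]_n.+1};
  dim_line : \dim line == 1 }.

HB.instance Definition _ := [isSub for line].
HB.instance Definition _ := [Choice of proj by <:].

Definition dir v (v0 : v != 0) : proj :=
  @Proj <[v]>%VS (introT eqP (etrans (dim_vline v) (congr1 nat_of_bool v0))).

Definition rep (p : proj) : 'cV[R]_n.+1 := vpick (line p).

Lemma rep_neq0 p : rep p != 0.
Proof. by rewrite vpick0 -dimv_eq0 (eqP (dim_line p)). Qed.

Lemma line_rep p : line p = <[rep p]>%VS.
Proof.
apply/eqP; rewrite eq_sym eqEdim -memvE memv_pick /=.
by rewrite dim_vline rep_neq0 (eqP (dim_line p)).
Qed.

Lemma dir_rep p : dir (rep_neq0 p) = p.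
Proof. by apply: val_inj; rewrite /= line_rep. Qed.

Lemma rep_dir v (v0 : v != 0) : exists2 c : R, c != 0 & rep (dir v0) = c *: v.
Proof.
have /vlineP[c cv] : rep (dir v0) \in <[v]>%VS by exact: memv_pick.
exists c => //; apply/eqP => c0; move: (rep_neq0 (dir v0)).
by rewrite cv c0 scale0r eqxx.
Qed.

Lemma eq_dir v w (v0 : v != 0) (w0 : w != 0) (c : R) :
  v = c *: w -> dir v0 = dir w0.
Proof.
move=> vw; apply: val_inj; apply/eqP; rewrite /= eqEdim !dim_vline v0 w0 andbT.
by rewrite -memvE vw memvZ ?memv_line.
Qed.

Definition pdist (p q : proj) : R :=
  wedge_norm (rep p) (rep q) / (enorm (rep p) * enorm (rep q)).

Lemma pdist_dir v w (v0 : v != 0) (w0 : w != 0) :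
  pdist (dir v0) (dir w0) = wedge_norm v w / (enorm v * enorm w).
Proof.
rewrite /pdist; have [a a0 ->] := rep_dir v0; have [b b0 ->] := rep_dir w0.
rewrite wedge_normZl wedge_normZr !enormZ.
have : enorm v != 0 by rewrite gt_eqF ?enorm_gt0.
have : enorm w != 0 by rewrite gt_eqF ?enorm_gt0.
move: a0 b0; rewrite -![_ != 0]normr_gt0 => /gt_eqF/negbT a0 /gt_eqF/negbT b0.
move=> /[!normr_gt0] ew ev; field.
by rewrite a0 b0 ev ew.
Qed.

(* sqrt 2 * pdist is the Hilbert-Schmidt distance of orthogonal projections *)
Let pmat (p : proj) (ij : 'I_n.+1 * 'I_n.+1) : R :=
  rep p ij.1 ord0 * rep p ij.2 ord0 / enorm (rep p) ^+ 2.

Let pmat_dot p q : \sum_ij pmat p ij * pmat q ij =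
  dotv (rep p) (rep q) ^+ 2 / (enorm (rep p) ^+ 2 * enorm (rep q) ^+ 2).
Proof.
rewrite expr2 {1 2}/dotv big_distrlr /= pair_bigA /= mulr_suml.
by apply: eq_bigr => ij _; rewrite /pmat mulf_div; congr (_ / _); ring.
Qed.

Let pdistE p q : pdist p q =
  Num.sqrt (\sum_ij (pmat p ij - pmat q ij) ^+ 2) / Num.sqrt 2.
Proof.
have -> : \sum_ij (pmat p ij - pmat q ij) ^+ 2 = \sum_ij pmat p ij * pmat p ij
    + \sum_ij pmat q ij * pmat q ij - 2 * \sum_ij pmat p ij * pmat q ij.
  by rewrite mulr_sumr -big_split -sumrB /=; apply: eq_bigr => ij _; ring.
rewrite !pmat_dot /pdist /wedge_norm -!enorm2.
have := rep_neq0 p; have := rep_neq0 q; rewrite -!enorm_gt0.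
set a := enorm (rep p); set b := enorm (rep q); set c := dotv _ _ => b0 a0.
have -> : (a ^+ 2) ^+ 2 / (a ^+ 2 * a ^+ 2) + (b ^+ 2) ^+ 2 / (b ^+ 2 * b ^+ 2)
    - 2 * (c ^+ 2 / (a ^+ 2 * b ^+ 2)) =
    2 * ((a ^+ 2 * b ^+ 2 - c ^+ 2) / (a * b) ^+ 2).
  by field; rewrite !gt_eqF.
have D0 : 0 <= a ^+ 2 * b ^+ 2 - c ^+ 2 by exact: wedge_norm_ge0.
rewrite (sqrtrM (_ / _))// [Num.sqrt 2 * _]mulrC mulfK ?gt_eqF ?sqrtr_gt0//.
by rewrite sqrtrM// sqrtrV ?sqr_ge0// sqrtr_sqr gtr0_norm ?mulr_gt0.
Qed.

Let pdistxx p : pdist p p = 0.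
Proof.
by rewrite pdistE big1 ?sqrtr0 ?mul0r// => ij _; rewrite subrr expr0n.
Qed.

Let pdist_sym p q : pdist p q = pdist q p.
Proof. by rewrite /pdist wedge_normC [X in _ / X]mulrC. Qed.

Let pdist_triangle q p r : pdist p r <= pdist p q + pdist q r.
Proof.
rewrite !pdistE -mulrDl ler_wpM2r ?invr_ge0 ?sqrtr_ge0//.
apply: le_trans (sum_Minkowski _ _).
rewrite (eq_bigr (fun ij => (pmat p ij - pmat q ij
  + (pmat q ij - pmat r ij)) ^+ 2)) // => ij _; congr (_ ^+ 2); ring.
Qed.

Let pdist_pos p q : pdist p q = 0 -> p = q.
Proof.
have p0 := rep_neq0 p; have q0 := rep_neq0 q.
have ep : 0 < enorm (rep p) by rewrite enorm_gt0.
have eq0 : 0 < enorm (rep q) by rewrite enorm_gt0.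
move=> /eqP; rewrite /pdist mulf_eq0 invr_eq0 (gt_eqF (mulr_gt0 ep eq0)) orbF.
rewrite sqrtr_eq0 => D0.
have {}D0 : enorm (rep p) ^+ 2 * enorm (rep q) ^+ 2 = dotv (rep p) (rep q) ^+ 2.
  by apply/eqP; rewrite -subr_eq0 eq_le D0 wedge_norm_ge0.
pose c := dotv (rep p) (rep q) / enorm (rep q) ^+ 2.
have pq : rep p = c *: rep q.
  apply/eqP; rewrite -subr_eq0 -dotvv_eq0 dotvBl !dotvBr !dotvZl !dotvZr.
  rewrite -!enorm2 (dotvC (rep q)); apply/eqP.
  have -> : enorm (rep p) ^+ 2 = dotv (rep p) (rep q) ^+ 2 / enorm (rep q) ^+ 2.
    by rewrite -D0 mulfK// expf_neq0// gt_eqF.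
  by rewrite /c; field; rewrite gt_eqF.
by rewrite -(dir_rep p) -(dir_rep q); apply: eq_dir pq.
Qed.

HB.instance Definition _ :=
  isMetric.Build R proj pdistxx pdist_pos pdist_sym pdist_triangle.

Let e0_neq0 : delta_mx ord0 ord0 != 0 :> 'cV[R]_n.+1.
Proof.
by apply/eqP => /matrixP/(_ ord0 ord0)/eqP; rewrite !mxE !eqxx oner_eq0.
Qed.

HB.instance Definition _ := isPointed.Build proj (dir e0_neq0).

Definition act (g : GL) (p : proj) : proj := dir (GLmx_neq0 g (rep_neq0 p)).

Lemma act_dir (g : GL) v (v0 : v != 0) :
  act g (dir v0) = dir (GLmx_neq0 g v0).
Proof.
have [c c0 cv] := rep_dir v0; apply: (@eq_dir _ _ _ _ c).
by rewrite cv scalemxAr.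
Qed.

Definition Nmax (g : GL) : R :=
  Num.max (opnorm (GLmx g)) (opnorm (invmx (GLmx g))).

Lemma Nmax_gt0 (g : GL) : 0 < Nmax g.
Proof.
rewrite /Nmax lt_max; apply/orP; left.
have e0 := e0_neq0; have := GLmx_neq0 g e0; rewrite -enorm_gt0.
move=> /lt_le_trans /(_ (enorm_opnorm _ _)).
by rewrite pmulr_lgt0 ?enorm_gt0.
Qed.

Definition rho (x : GL * proj) : R :=
  ln (enorm (GLmx x.1 *m rep x.2) / enorm (rep x.2)).

Lemma rho_dir (g : GL) v (v0 : v != 0) :
  rho (g, dir v0) = ln (enorm (GLmx g *m v) / enorm v).
Proof.
rewrite /rho /=; have [c c0 ->] := rep_dir v0.
rewrite -scalemxAr !enormZ -mulf_div divff ?mul1r// normr_eq0 //.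
Qed.

End Spaces.

Notation stateX R n := (GL R n * proj R n)%type.

Section Kernel.
Variables (R : realType) (n : nat).

Definition chain_step (x : stateX R n) (g1 : borel (GL R n)) : borel (stateX R n) :=
  (g1, act x.1 x.2).

Lemma measurable_chain_step x : measurable_fun setT (chain_step x).
Proof.
apply: (@continuous_borel_measurable (GL R n) (stateX R n)) => g A.
move=> [[/= B C] [gB xC] BCA]; rewrite /chain_step /=; apply: filterS gB => g1 Bg1.
by apply: BCA; split => //=; exact: nbhs_singleton xC.
Qed.

HB.instance Definition _ x :=
  isMeasurableFun.Build _ _ _ _ (chain_step x) (measurable_chain_step x).

(* transition mu x is the probability measure P(x, .) *)
Definition transition (mu : probability (borel (GL R n)) R) (x : stateX R n) :
  probability (borel (stateX R n)) R := distribution mu (chain_step x).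


Lemma ge0_integral_transition mu x (h : borel (stateX R n) -> \bar R) :
  measurable_fun setT h -> (forall y, (0 <= h y)%E) ->
  (\int[transition mu x]_y h y = \int[mu]_g1 h (g1, act x.1 x.2))%E.
Proof. by move=> mh h0; rewrite ge0_integral_distribution. Qed.

Definition L1 (P : probability (borel (stateX R n)) R) (h : stateX R n -> R[i]^o) :=
  measurable_fun setT (h : borel (stateX R n) -> borel R[i]^o) /\
  (\int[P]_x (Normc.normc (h x))%:E < +oo)%E.

End Kernel.

(* The supremum of |f i| / w i over i in D, in [0, +oo]: it is 0 when D is
   empty, as happens for pairs of distinct points of P(R^1). *)
Definition supratio (R : realType) (I : Type) (D : set I) (f : I -> R[i])
    (w : I -> R) : \bar R :=
  ereal_sup (0%E |` [set (Normc.normc (f i) / w i)%:E | i in D]).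

Section Supratio.
Context {R : realType} {I : Type} {D : set I} {w : I -> R}.
Implicit Types (f g : I -> R[i]) (c : R[i]).

Lemma supratio_ge0 f : (0 <= supratio D f w)%E.
Proof. by apply: ereal_sup_ubound; left. Qed.

Lemma supratio_ub f i : D i ->
  ((Normc.normc (f i) / w i)%:E <= supratio D f w)%E.
Proof. by move=> Di; apply: ereal_sup_ubound; right; exists i. Qed.

Lemma supratio_le f (M : \bar R) : (0 <= M)%E ->
  (forall i, D i -> ((Normc.normc (f i) / w i)%:E <= M)%E) ->
  (supratio D f w <= M)%E.
Proof.
move=> M0 fM; apply: ge_ereal_sup => _ [->|[i Di <-]]//; exact: fM.
Qed.

Hypothesis w_ge0 : forall i, 0 <= w i.

Lemma supratioD f g :
  (supratio D (fun i => f i + g i)%R w <= supratio D f w + supratio D g w)%E.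
Proof.
apply: supratio_le => [|i Di]; first by rewrite adde_ge0 ?supratio_ge0.
apply: le_trans (leeD (supratio_ub f Di) (supratio_ub g Di)).
by rewrite -EFinD lee_fin -mulrDl ler_wpM2r ?invr_ge0//; exact: le_normcD.
Qed.

Lemma supratioZ c f :
  (supratio D (fun i => c * f i)%R w <= (Normc.normc c)%:E * supratio D f w)%E.
Proof.
have c0 : 0 <= Normc.normc c by case: c => a b; exact: sqrtr_ge0.
apply: supratio_le => [|i Di]; first by rewrite mule_ge0 ?supratio_ge0.
rewrite Normc.normcM -mulrA EFinM; apply: lee_wpmul2l; first by rewrite lee_fin.
exact: supratio_ub.
Qed.

End Supratio.

Section Bspace.
Variables (R : realType) (n : nat).
Implicit Types (h : stateX R n -> R[i]^o).

Definition norm_theta (theta : R) h : \bar R :=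
  supratio setT h (fun x => Nmax x.1 `^ theta).

Definition k_proj (eps alpha : R) h : \bar R :=
  supratio [set z : GL R n * (proj R n * proj R n) | z.2.1 != z.2.2]
    (fun z => h (z.1, z.2.1) - h (z.1, z.2.2))
    (fun z => pdist z.2.1 z.2.2 `^ eps * Nmax z.1 `^ alpha).

Definition k_GL (eps beta : R) h : \bar R :=
  supratio [set z : (GL R n * GL R n) * proj R n | z.1.1 != z.1.2]
    (fun z => h (z.1.1, z.2) - h (z.1.2, z.2))
    (fun z => opnorm (GLmx z.1.1 - GLmx z.1.2) `^ eps
              * Nmax z.1.1 `^ beta * Nmax z.1.2 `^ beta).

Definition Bnorm (delta0 : R) h : \bar R :=
  let eps := delta0 / 8 in
  (norm_theta (3 * eps) h + k_proj eps (5 * eps) h + k_GL eps (7 * eps) h)%E.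

Definition inB (delta0 : R) : {pred stateX R n -> R[i]^o} :=
  fun h => `[< continuous h /\ (Bnorm delta0 h < +oo)%E >].

Variable delta0 : R.

Lemma Bnorm_ge0 h : (0 <= Bnorm delta0 h)%E.
Proof. by rewrite !adde_ge0 ?supratio_ge0. Qed.

Lemma BnormD h1 h2 :
  (Bnorm delta0 (h1 + h2)%R <= Bnorm delta0 h1 + Bnorm delta0 h2)%E.
Proof.
rewrite /Bnorm /= [leRHS]addeACA [X in (_ <= X + _)%E]addeACA.
apply: leeD; first apply: leeD.
- by apply: supratioD => x; exact: powR_ge0.
- have -> : k_proj (delta0 / 8) (5 * (delta0 / 8)) (h1 + h2) = supratio
      [set z : GL R n * (proj R n * proj R n) | z.2.1 != z.2.2]
      (fun z => (h1 (z.1, z.2.1) - h1 (z.1, z.2.2))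
                + (h2 (z.1, z.2.1) - h2 (z.1, z.2.2)))
      (fun z => pdist z.2.1 z.2.2 `^ (delta0 / 8) * Nmax z.1 `^ (5 * (delta0 / 8))).
    by congr supratio; apply/funext => z; rewrite /= opprD addrACA.
  by apply: supratioD => x; rewrite mulr_ge0 ?powR_ge0.
- have -> : k_GL (delta0 / 8) (7 * (delta0 / 8)) (h1 + h2) = supratio
      [set z : (GL R n * GL R n) * proj R n | z.1.1 != z.1.2]
      (fun z => (h1 (z.1.1, z.2) - h1 (z.1.2, z.2))
                + (h2 (z.1.1, z.2) - h2 (z.1.2, z.2)))
      (fun z => opnorm (GLmx z.1.1 - GLmx z.1.2) `^ (delta0 / 8)
        * Nmax z.1.1 `^ (7 * (delta0 / 8)) * Nmax z.1.2 `^ (7 * (delta0 / 8))).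
    by congr supratio; apply/funext => z; rewrite /= opprD addrACA.
  by apply: supratioD => x; rewrite !mulr_ge0 ?powR_ge0.
Qed.

Lemma BnormZ_le (c : R[i]) h :
  (Bnorm delta0 (c *: h)%R <= (Normc.normc c)%:E * Bnorm delta0 h)%E.
Proof.
rewrite /Bnorm /= !ge0_muleDr ?adde_ge0 ?supratio_ge0//.
apply: leeD; first apply: leeD.
- by apply: supratioZ => x; exact: powR_ge0.
- have -> : k_proj (delta0 / 8) (5 * (delta0 / 8)) (c *: h) = supratio
      [set z : GL R n * (proj R n * proj R n) | z.2.1 != z.2.2]
      (fun z => c * (h (z.1, z.2.1) - h (z.1, z.2.2)))
      (fun z => pdist z.2.1 z.2.2 `^ (delta0 / 8) * Nmax z.1 `^ (5 * (delta0 / 8))).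
    by congr supratio; apply/funext => z; rewrite /= mulrBr.
  by apply: supratioZ => x; rewrite mulr_ge0 ?powR_ge0.
- have -> : k_GL (delta0 / 8) (7 * (delta0 / 8)) (c *: h) = supratio
      [set z : (GL R n * GL R n) * proj R n | z.1.1 != z.1.2]
      (fun z => c * (h (z.1.1, z.2) - h (z.1.2, z.2)))
      (fun z => opnorm (GLmx z.1.1 - GLmx z.1.2) `^ (delta0 / 8)
        * Nmax z.1.1 `^ (7 * (delta0 / 8)) * Nmax z.1.2 `^ (7 * (delta0 / 8))).
    by congr supratio; apply/funext => z; rewrite /= mulrBr.
  by apply: supratioZ => x; rewrite !mulr_ge0 ?powR_ge0.
Qed.

Lemma inB_fin h : h \in inB delta0 -> Bnorm delta0 h \is a fin_num.
Proof. by move/asboolP => -[_ hoo]; rewrite ge0_fin_numE ?Bnorm_ge0. Qed.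

Lemma inB_submod_closed : submod_closed (inB delta0).
Proof.
have BnormC0 : Bnorm delta0 0 = 0%E.
  apply/eqP; rewrite eq_le Bnorm_ge0 andbT.
  have := BnormZ_le 0 0; rewrite scale0r Normc.normc0 mul0e; exact.
split; first by apply/asboolP; split; [exact: cst_continuous|rewrite BnormC0 ltry].
move=> c h1 h2 /asboolP[c1 f1] /asboolP[c2 f2]; apply/asboolP; split.
  move=> x; apply: cvgD; last exact: c2.
  by apply: cvgZl_tmp; exact: c1.
apply: le_lt_trans (BnormD _ _) _; rewrite lte_add_pinfty//.
apply: le_lt_trans (BnormZ_le _ _) _.
by rewrite lte_mul_pinfty// lee_fin; case: c => a b; exact: sqrtr_ge0.
Qed.

HB.instance Definition _ :=
  GRing.isSubmodClosed.Build R[i] (stateX R n -> R[i]^o) (inB delta0)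
    inB_submod_closed.

Record Bspace := MkBspace {
  Bfun :> stateX R n -> R[i]^o;
  BfunP : Bfun \in inB delta0 }.

HB.instance Definition _ := [isSub for Bfun].
HB.instance Definition _ := [Choice of Bspace by <:].
HB.instance Definition _ := [SubChoice_isSubLmodule of Bspace by <:].

Definition Bspace_norm (h : Bspace) : R[i] := (fine (Bnorm delta0 h))%:C.

Lemma fine_BnormE (h : Bspace) : (fine (Bnorm delta0 h))%:E = Bnorm delta0 h.
Proof. by rewrite fineK// inB_fin// BfunP. Qed.

Lemma Bspace_normD (h1 h2 : Bspace) :
  Bspace_norm (h1 + h2) <= Bspace_norm h1 + Bspace_norm h2.
Proof.
rewrite -rmorphD/= lecR -lee_fin EFinD !fine_BnormE; exact: BnormD.
Qed.

Lemma Bspace_normZ_le (c : R[i]) (h : Bspace) :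
  Bspace_norm (c *: h) <= `|c| * Bspace_norm h.
Proof.
rewrite -[`|c|]/((Normc.normc c)%:C) -rmorphM/= lecR -lee_fin EFinM.
rewrite !fine_BnormE; exact: BnormZ_le.
Qed.

Lemma Bspace_normZ (c : R[i]) (h : Bspace) :
  Bspace_norm (c *: h) = `|c| * Bspace_norm h.
Proof.
apply/eqP; rewrite eq_le Bspace_normZ_le/=.
have [->|c0] := eqVneq c 0.
  by rewrite normr0 mul0r lecR fine_ge0// Bnorm_ge0.
rewrite -ler_pdivlMl ?normr_gt0// -normfV.
by apply: le_trans (Bspace_normZ_le _ _); rewrite scalerA mulVf// scale1r.
Qed.

Lemma Bspace_norm_eq0 (h : Bspace) : Bspace_norm h = 0 -> h = 0.
Proof.
move=> [h0].
apply: val_inj; apply/funext => x /=.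
have Bh0 : Bnorm delta0 h = 0%E by rewrite -fine_BnormE h0.
have : ((Normc.normc (h x) / Nmax x.1 `^ (3 * (delta0 / 8)))%:E <= 0)%E.
  rewrite -Bh0 /Bnorm -addeA; apply: le_trans (leeDl _ _).
    exact: (@supratio_ub _ _ _ (fun x => Nmax x.1 `^ _)).
  by rewrite adde_ge0 ?supratio_ge0.
rewrite lee_fin pmulr_lle0 ?invr_gt0 ?powR_gt0 ?Nmax_gt0// => hx.
apply: Normc.eq0_normc; apply/eqP; rewrite eq_le hx/=.
by case: (h x) => a b; exact: sqrtr_ge0.
Qed.

HB.instance Definition _ := Lmodule_isNormed.Build R[i] Bspace
  Bspace_normD Bspace_normZ Bspace_norm_eq0.

End Bspace.

Arguments inB {R} n delta0.
Arguments Bspace {R} n delta0.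

Definition dual (K : numFieldType) (V : normedModType K) : set (V -> K^o) :=
  [set phi | linear phi /\ continuous phi].

Definition expi (R : realType) (t : R) : R[i] := cos t +i* sin t.

(* Main.v *)
Require Import Defs.
From HB Require Import structures.
From mathcomp Require Import all_boot all_order all_algebra.
From mathcomp Require Import all_classical all_reals all_analysis.
From mathcomp Require Import measurable_realfun complex ring lra.
Import Order.TTheory GRing.Theory Num.Theory numFieldNormedType.Exports.
Local Open Scope classical_set_scope.
Local Open Scope ring_scope.
Local Open Scope complex_scope.

(** Everything rests on two facts about N(g) = max (|g|, |g^-1|): it is at
    least 1, so that its powers increase with the exponent, and it controls the
    cocycle rho (g, p) = ln (|gv| / |v|), where p is the line through v.

    That the constant 1 lies in B, that evaluation at x is bounded by
    N(g)^theta, and that B lies in L^1(P(x, .)) are then direct. For the last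
    one, |h(g1, g.u)| <= C N(g1)^(3 delta0/8) <= C N(g1)^delta0, which is
    mu-integrable by hypothesis.

    For the multiplication by exp(i t rho), write E = exp(i t rho) and
      E x h x - E y h y = E x (h x - h y) + (E x - E y) h y.
    The first term has the modulus of h x - h y. In the second, h y costs
    N^(3 eps), and |E x - E y| is at most 2 |rho x - rho y|^eps because
    |exp(ia) - exp(ib)| <= min (2, 2 |a - b|) and 0 < eps <= 1. The cocycle
    satisfies
      |rho (g, p) - rho (g, q)| <= 2 N(g)^2 d(p, q)             [rho_dist_proj]
      |rho (g, p) - rho (g', p)| <= |g - g'| N(g) N(g')         [rho_dist_GL]
    because |gv| / |v| is at least 1 / N(g) and is Lipschitz in g and in p. Raised
    to the power eps, the first bound costs N^(2 eps), which brings the weight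
    to N^(5 eps): this is exactly alpha. The second costs
    N(g)^eps N(g')^eps, and the product N(g)^eps N(g')^(4 eps) is below
    N(g)^beta N(g')^beta. The inclusion holds as soon as |t| <= 1, hence for
    kappa = 1/2. *)

(** * Euclidean norm and operator norm *)

Section EuclideanNorm.
Context {R : realType} {n : nat}.
Implicit Types (u v w : 'cV[R]_n.+1) (M : 'M[R]_n.+1).

Lemma enorm_ge0 v : 0 <= enorm v.
Proof. exact: sqrtr_ge0. Qed.

Lemma enormD u v : enorm (u + v) <= enorm u + enorm v.
Proof.
have dotE w : dotv w w = \sum_i w i ord0 ^+ 2.
  by apply: eq_bigr => i _; rewrite expr2.
rewrite /enorm !dotE.
under eq_bigr do rewrite mxE.
exact: sum_Minkowski.
Qed.

Lemma ler_dist_enorm u v : `|enorm u - enorm v| <= enorm (u - v).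
Proof.
have vu : enorm (v - u) = enorm (u - v).
  by rewrite -opprB -scaleN1r enormZ normrN1 mul1r.
rewrite ler_norml; apply/andP; split.
- by have := enormD (v - u) u; rewrite subrK vu; lra.
- by have := enormD (u - v) v; rewrite subrK; lra.
Qed.

Lemma opnorm_ge0 M : 0 <= opnorm M.
Proof.
have : 0 < enorm (const_mx 1 : 'cV[R]_n.+1).
  rewrite enorm_gt0; apply/eqP => /matrixP/(_ ord0 ord0)/eqP.
  by rewrite !mxE oner_eq0.
set v := const_mx 1 => v0; rewrite -(pmulr_lge0 _ v0).
exact: le_trans (enorm_ge0 (M *m v)) (enorm_opnorm M v).
Qed.

Lemma opnorm_eq0 M : opnorm M = 0 -> M = 0.
Proof.
move=> M0; apply/matrixP => i j; rewrite mxE.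
have : enorm (M *m delta_mx j ord0) <= 0.
  by apply: le_trans (enorm_opnorm _ _) _; rewrite M0 mul0r.
rewrite leNgt enorm_gt0 negbK -colE => /eqP/matrixP/(_ i ord0).
by rewrite !mxE.
Qed.

(** The entrywise l^1 norm dominates the Hilbert-Schmidt norm. It is continuous
    entry by entry, which gives continuity of g |-> |g - g0| at g0. *)
Lemma opnorm_le_sum M : opnorm M <= \sum_i \sum_j `|M i j|.
Proof.
have S0 : 0 <= \sum_i \sum_j `|M i j|.
  by apply: sumr_ge0 => i _; apply: sumr_ge0.
have sq_le (I : finType) (a : I -> R) : (forall i, 0 <= a i) ->
    \sum_i a i ^+ 2 <= (\sum_i a i) ^+ 2.
  move=> a0; rewrite [leRHS]expr2 big_distrl/=; apply: ler_sum => i _.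
  rewrite expr2 ler_wpM2l// (bigD1 i)//= lerDl.
  by apply: sumr_ge0 => j _.
have HS : Num.sqrt (\sum_i \sum_j M i j ^+ 2) <= \sum_i \sum_j `|M i j|.
  rewrite -[leRHS](ger0_norm S0) -sqrtr_sqr ler_sqrt ?sqr_ge0//.
  apply: le_trans (sq_le _ _ _); last by move=> i; apply: sumr_ge0.
  apply: ler_sum => i _; apply: le_trans (sq_le _ _ _) => //.
  by apply: ler_sum => j _; rewrite real_normK ?num_real.
apply: le_trans HS; apply: ge_sup => [|_ [v /= v1 <-]].
  (* the supremum defining opnorm runs over a nonempty set *)
  pose v : 'cV[R]_n.+1 := delta_mx ord0 ord0.
  have v0 : 0 < enorm v.
    rewrite enorm_gt0; apply/eqP => /matrixP/(_ ord0 ord0)/eqP.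
    by rewrite !mxE oner_eq0.
  exists (enorm (M *m ((enorm v)^-1 *: v))); exists ((enorm v)^-1 *: v) => //=.
  by rewrite enormZ ger0_norm ?invr_ge0 ?ltW// mulVf ?gt_eqF.
by apply: le_trans (enorm_mulmx M v) _; rewrite v1 mulr1.
Qed.

End EuclideanNorm.

(** * Logarithm and complex exponential *)

(** The bound is ln (1 + x) <= x at x = a / b - 1, for b <= a. *)
Lemma ler_dist_ln {R : realType} (m a b : R) : 0 < m -> m <= a -> m <= b ->
  `|ln a - ln b| <= `|a - b| / m.
Proof.
move=> m0; wlog ba : a b / b <= a => [H ma mb|ma mb].
  have [/H|/ltW/H] := leP b a; first exact.
  by rewrite distrC (distrC a); exact.
have a0 : 0 < a by exact: lt_le_trans ma.
have b0 : 0 < b by exact: lt_le_trans mb.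
rewrite !ger0_norm ?subr_ge0 ?ler_ln//.
rewrite -ln_div ?posrE//.
have -> : a / b = 1 + (a - b) / b by field; rewrite gt_eqF.
apply: le_trans (le_ln1Dx _) _.
  by rewrite (@lt_le_trans _ _ 0)// ?ltrN10// divr_ge0 ?subr_ge0// ltW.
by rewrite ler_wpM2l ?subr_ge0// lef_pV2 ?posrE.
Qed.

Section Complex.
Context {R : realType}.
Implicit Types (a b t : R) (z : R[i]).

Lemma normc_ge0 z : 0 <= Normc.normc z.
Proof. by case: z => a b; exact: sqrtr_ge0. Qed.

Lemma normc_normr z : (Normc.normc z)%:C = `|z|.
Proof. by []. Qed.

Lemma continuous_normc :
  continuous (fun z : R[i]^o => Normc.normc z).
Proof.
move=> z; apply/(@cvgrPdist_lt _ _ _ (nbhs z)) => e e0.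
have : \forall w \near z, `|z - w| < e%:C.
  by apply: nbhsx_ballx; rewrite ltcR.
apply: (@filterS _ _ (nbhs_filter z)) => w.
rewrite -normc_normr ltcR; apply: le_lt_trans.
rewrite ler_norml; apply/andP; split.
- have := le_normcD (w - z) z; rewrite subrK -(normcN (w - z)) opprB; lra.
- have := le_normcD (z - w) w; rewrite subrK; lra.
Qed.

Lemma normc_expi t : Normc.normc (expi t) = 1.
Proof. by rewrite /expi /= cos2Dsin2 sqrtr1. Qed.

Lemma ler_dist_derive1 (f df : R -> R) :
  (forall x : R, is_derive x 1 f (df x)) -> (forall x, `|df x| <= 1) ->
  forall a b, `|f a - f b| <= `|a - b|.
Proof.
move=> fdf df1 a b; wlog ab : a b / b <= a => [H|].
  have [/H//|/ltW/H] := leP b a.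
  by rewrite distrC (distrC b).
have [|c _ ->] := @MVT_segment R f df b a ab (fun x _ => fdf x).
  apply: continuous_subspaceT => x; apply: differentiable_continuous.
  by apply/derivable1_diffP; exact: ex_derive.
by rewrite normrM ler_piMl.
Qed.

Lemma normc_dist_expi a b : Normc.normc (expi a - expi b) <= 2 * `|a - b|.
Proof.
have Hc : `|cos a - cos b| <= `|a - b|.
  apply: (@ler_dist_derive1 _ (fun x => - sin x)) => x.
  by rewrite normrN ler_norml sin_geN1 sin_le1.
have Hs : `|sin a - sin b| <= `|a - b|.
  by apply: (@ler_dist_derive1 _ cos) => x; rewrite ler_norml cos_geN1 cos_le1.
rewrite /expi /= -[leRHS]ger0_norm ?mulr_ge0// -sqrtr_sqr ler_sqrt ?sqr_ge0//.
rewrite -(real_normK (num_real (cos a - cos b))).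
rewrite -(real_normK (num_real (sin a - sin b))).
have c0 := normr_ge0 (cos a - cos b); have s0 := normr_ge0 (sin a - sin b).
by nra.
Qed.

Lemma expi_continuous : continuous (@expi R : R -> R[i]^o).
Proof.
move=> a; apply/cvgrPdist_lt => e e0.
have [r r0 ->] : exists2 r : R, 0 < r & e = r%:C.
  by exists (complex.Re e); [move: e0; rewrite ltcE => /andP[]
    |rewrite RRe_real// gtr0_real].
have : \forall b \near a, `|a - b| < r / 2.
  by apply: nbhsx_ballx; rewrite divr_gt0.
apply: filterS => b ab; rewrite -normc_normr ltcR.
apply: le_lt_trans (normc_dist_expi _ _) _.
by rewrite mulrC -ltr_pdivlMr.
Qed.

(** This is where eps <= 1 enters: 2|a - b| is at most 2|a - b|^eps when
    |a - b| <= 1, and the trivial bound 2 takes over beyond. *)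
Lemma normc_dist_expi_powR (eps a b : R) : 0 < eps <= 1 ->
  Normc.normc (expi a - expi b) <= 2 * `|a - b| `^ eps.
Proof.
move=> /andP[e0 e1]; have [ab1|/ltW ab1] := leP `|a - b| 1.
  apply: le_trans (normc_dist_expi a b) _; rewrite ler_pM2l//.
  have [->|/eqP ab0] := eqVneq `|a - b| 0; first by rewrite powR_ge0.
  rewrite -[leLHS]powRr1//; apply: ger_powR => //.
  by rewrite ab1 andbT lt_neqAle eq_sym normr_ge0 andbT; apply/eqP.
apply: le_trans (_ : 2 <= _).
  apply: le_trans (le_normcD _ _) _.
  by rewrite normcN !normc_expi.
rewrite ler_peMr//; have <- : 1 `^ eps = 1 :> R by rewrite powR1.
by apply: ge0_ler_powR; rewrite ?nnegrE// ltW.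
Qed.

End Complex.

(** * The stretching factor and the cocycle *)

Section Projective.
Context {R : realType} {n : nat}.
Implicit Types (g : GL R n) (p q : Defs.proj R n).

Lemma Nmax_opnorm g : opnorm (GLmx g) <= Nmax g.
Proof. by rewrite le_max lexx. Qed.

Lemma enorm_le_Nmax g v : enorm v <= Nmax g * enorm (GLmx g *m v).
Proof.
rewrite -{1}[v](mulKmx (GLmx_unit g)).
apply: le_trans (enorm_opnorm _ _) _.
by rewrite ler_wpM2r ?enorm_ge0// le_max lexx orbT.
Qed.

(** 1 = |g^-1 g| <= |g^-1| |g| <= N(g)^2. *)
Lemma Nmax_ge1 g : 1 <= Nmax g.
Proof.
have v0 := rep_neq0 (point : Defs.proj R n); set v := rep _ in v0.
have N0 := Nmax_gt0 g; rewrite -enorm_gt0 in v0.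
have : enorm v <= Nmax g * (Nmax g * enorm v).
  apply: le_trans (enorm_le_Nmax g v) _; rewrite ler_pM2l//.
  by apply: le_trans (enorm_opnorm _ _) _; rewrite ler_pM2r// Nmax_opnorm.
rewrite mulrA -{1}[enorm v]mul1r ler_pM2r// -expr2 => N2.
by rewrite -(@expr_ge1 _ 2)// ltW.
Qed.

Lemma pdist_ge0 p q : 0 <= pdist p q.
Proof. exact: (mdist_ge0 (p : Defs.proj R n) q). Qed.

Lemma pdist_gt0 p q : (0 < pdist p q) = (p != q).
Proof. exact: (mdist_gt0 (p : Defs.proj R n) q). Qed.

Lemma Nmax_ge0 g : 0 <= Nmax g.
Proof. exact/ltW/Nmax_gt0. Qed.

(** The cocycle is its logarithm. Unlike rho, the stretching factor is
    Lipschitz in the line and in the matrix, with constants that do not involve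
    g^-1. *)
Definition stretch g p : R := enorm (GLmx g *m rep p) / enorm (rep p).

Lemma stretch_dir g v (v0 : v != 0) :
  stretch g (dir v0) = enorm (GLmx g *m v) / enorm v.
Proof.
rewrite /stretch; have [c c0 ->] := rep_dir v0.
by rewrite -scalemxAr !enormZ -mulf_div divff ?mul1r// normr_eq0.
Qed.

Lemma exists_unit_dir p :
  exists2 u, enorm u = 1 & exists u0 : u != 0, p = dir u0.
Proof.
have p0 : 0 < enorm (rep p) by rewrite enorm_gt0 rep_neq0.
exists ((enorm (rep p))^-1 *: rep p).
  by rewrite enormZ ger0_norm ?invr_ge0 ?ltW// mulVf ?gt_eqF.
have u0 : (enorm (rep p))^-1 *: rep p != 0.
  by rewrite scaler_eq0 negb_or invr_eq0 gt_eqF//= rep_neq0.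
exists u0; rewrite -{1}(dir_rep p).
apply: (@eq_dir _ _ _ _ _ _ (enorm (rep p))).
by rewrite scalerA divff ?scale1r// gt_eqF.
Qed.

(** Unit vectors are determined by their lines up to sign. Choosing the signs so
    that c = <u, v> >= 0 makes the vectors as close as the lines:
    |u - v|^2 = 2 (1 - c) <= 2 (1 - c^2) = 2 d(p, q)^2. *)
Lemma exists_aligned_unit_dirs p q :
  exists u v, [/\ enorm u = 1, enorm v = 1,
    exists u0 : u != 0, p = dir u0, exists v0 : v != 0, q = dir v0
    & enorm (u - v) <= 2 * pdist p q].
Proof.
have [u u1 [u0 pu]] := exists_unit_dir p.
have [w w1 [w0 qw]] := exists_unit_dir q.
have [v [v1 [v0 qv] uv]] : exists v, [/\ enorm v = 1,
    exists v0 : v != 0, q = dir v0 & 0 <= dotv u v].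
  have [uw|/ltW uw] := leP 0 (dotv u w); first by
    exists w; split=> //; exists w0.
  have w'0 : - w != 0 by rewrite oppr_eq0.
  exists (- w); split.
  - by rewrite -scaleN1r enormZ normrN1 mul1r.
  - exists w'0; rewrite qw; apply: (@eq_dir _ _ _ _ _ _ (-1)).
    by rewrite scaleN1r opprK.
  - by rewrite -scaleN1r dotvZr mulN1r oppr_ge0.
exists u, v; split => //; [by exists u0|by exists v0|].
rewrite pu qv pdist_dir u1 v1 mulr1 divr1 /wedge_norm u1 v1 expr1n mul1r.
have D0 : 0 <= 1 - dotv u v ^+ 2.
  by have := wedge_norm_ge0 u v; rewrite u1 v1 expr1n mul1r.
rewrite -(@ler_pXn2r _ 2)// ?nnegrE ?mulr_ge0 ?sqrtr_ge0//.
rewrite enorm2 exprMn sqr_sqrtr// dotvBl !dotvBr (dotvC v u) -!enorm2 u1 v1.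
set c := dotv u v in D0 uv *.
have : c <= 1 by nra.
by nra.
Qed.

Lemma stretch_gt0 g p : 0 < stretch g p.
Proof. by rewrite divr_gt0// enorm_gt0 ?GLmx_neq0 ?rep_neq0. Qed.

Lemma stretch_ge g p : (Nmax g)^-1 <= stretch g p.
Proof.
have p0 : 0 < enorm (rep p) by rewrite enorm_gt0 rep_neq0.
rewrite /stretch ler_pdivlMr// ler_pdivrMl ?Nmax_gt0//.
exact: enorm_le_Nmax.
Qed.

Lemma stretch_dist_proj g p q :
  `|stretch g p - stretch g q| <= 2 * opnorm (GLmx g) * pdist p q.
Proof.
have [u [v [u1 v1 [u0 ->] [v0 ->] uv]]] := exists_aligned_unit_dirs p q.
rewrite !stretch_dir u1 v1 !divr1.
apply: le_trans (ler_dist_enorm _ _) _; rewrite -mulmxBr.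
apply: le_trans (enorm_opnorm _ _) _.
by rewrite (mulrC 2) -mulrA ler_wpM2l// opnorm_ge0.
Qed.

Lemma stretch_dist_GL g g' p :
  `|stretch g p - stretch g' p| <= opnorm (GLmx g - GLmx g').
Proof.
have [u u1 [u0 ->]] := exists_unit_dir p.
rewrite !stretch_dir u1 !divr1.
apply: le_trans (ler_dist_enorm _ _) _; rewrite -mulmxBl.
by apply: le_trans (enorm_opnorm _ _) _; rewrite u1 mulr1.
Qed.

Lemma rho_dist_proj g p q :
  `|rho (g, p) - rho (g, q)| <= 2 * (Nmax g * Nmax g) * pdist p q.
Proof.
have N0 := Nmax_gt0 g.
apply: le_trans (ler_dist_ln _ _ _ _ (stretch_ge g p) (stretch_ge g q)) _.
  by rewrite invr_gt0.
rewrite invrK; apply: le_trans (ler_wpM2r (ltW N0) (stretch_dist_proj g p q)) _.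
rewrite mulrAC ler_wpM2r ?pdist_ge0// mulrA ler_pM2r// ler_pM2l//.
exact: Nmax_opnorm.
Qed.

(** The two stretching factors are bounded below by 1 / N(g) and 1 / N(g');
    since N >= 1, the product 1 / (N(g) N(g')) is a common lower bound. *)
Lemma rho_dist_GL g g' p :
  `|rho (g, p) - rho (g', p)| <= opnorm (GLmx g - GLmx g') * (Nmax g * Nmax g').
Proof.
have N0 := Nmax_gt0 g; have N'0 := Nmax_gt0 g'.
have NN0 : 0 < (Nmax g * Nmax g')^-1 by rewrite invr_gt0 mulr_gt0.
apply: le_trans (ler_dist_ln _ _ _ NN0 _ _) _.
- apply: le_trans (stretch_ge g p).
  by rewrite lef_pV2 ?posrE ?mulr_gt0// ler_peMr ?Nmax_ge1// ltW.
- apply: le_trans (stretch_ge g' p).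
  by rewrite lef_pV2 ?posrE ?mulr_gt0// ler_peMl ?Nmax_ge1// ltW.
by rewrite invrK ler_wpM2r ?stretch_dist_GL// ltW// mulr_gt0.
Qed.

Lemma GLmx_continuous : continuous (@GLmx R n).
Proof. exact: initial_continuous. Qed.

Lemma continuous_sum_dist (M0 : 'M[R]_n.+1) :
  continuous (fun M : 'M[R]_n.+1 => \sum_i \sum_j `|M i j - M0 i j|).
Proof.
apply: continuous_big => [|i _]; first exact: add_continuous.
apply: continuous_big => [|j _]; first exact: add_continuous.
move=> M.
exact: (cvg_norm (cvgB (@coord_continuous R _ _ i j M) (cvg_cst _))).
Qed.

Lemma cvg_opnorm_dist g :
  opnorm (GLmx g' - GLmx g) @[g' --> g] --> (0 : R).
Proof.
pose D (M : 'M[R]_n.+1) := \sum_i \sum_j `|M i j - GLmx g i j|.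
apply: (@squeeze_cvgr _ (nbhs g) _ R (fun=> 0) (D \o @GLmx R n)).
- near=> g'; rewrite opnorm_ge0; apply: le_trans (opnorm_le_sum _) _ => /=.
  by apply: ler_sum => i _; apply: ler_sum => j _; rewrite !mxE.
- exact: cvg_cst.
- have D0 : D (GLmx g) = 0.
    by apply: big1 => i _; apply: big1 => j _; rewrite subrr normr0.
  rewrite -[X in _ --> X]D0.
  apply: continuous_comp; first exact: GLmx_continuous.
  exact: continuous_sum_dist.
Unshelve. all: by end_near. Qed.

(** Both Lipschitz bounds are used at the base point: the only constant is the
    norm of the fixed matrix g, so a neighbourhood of g and one of p can be
    chosen independently. *)
Lemma stretch_continuous : continuous (fun x : stateX R n => stretch x.1 x.2).
Proof.
move=> [g p] /=; apply/cvgrPdist_lt => e e0.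
(* the + 1 only makes the divisor positive *)
have K0 : 0 < 2 * opnorm (GLmx g) + 1 by rewrite ltr_wpDl ?mulr_ge0 ?opnorm_ge0.
have Hg : \forall g' \near g, opnorm (GLmx g' - GLmx g) < e / 2.
  have /cvgrPdist_lt/(_ (e / 2)) := cvg_opnorm_dist g.
  rewrite divr_gt0// => /(_ isT); apply: filterS => g'.
  by rewrite sub0r normrN ger0_norm ?opnorm_ge0.
have Hp : \forall q \near p, pdist p q < e / 2 / (2 * opnorm (GLmx g) + 1).
  by apply: nbhsx_ballx; rewrite !divr_gt0.
exists ([set g' | opnorm (GLmx g' - GLmx g) < e / 2],
        [set q | pdist p q < e / 2 / (2 * opnorm (GLmx g) + 1)]) => //.
move=> [g' q] /= [Hg' Hq].
rewrite [X in X < _](_ : _ = `|(stretch g p - stretch g q)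
  - (stretch g' q - stretch g q)|); last first.
  by congr `|_|; ring.
apply: le_lt_trans (ler_normB _ _) _; rewrite [ltRHS]splitr ltrD//; last first.
  exact: le_lt_trans (stretch_dist_GL _ _ _) Hg'.
apply: le_lt_trans (stretch_dist_proj _ _ _) _.
rewrite ltr_pdivlMr// in Hq; apply: le_lt_trans Hq.
rewrite mulrC ler_wpM2l ?pdist_ge0// lerDl ler01//.
Qed.

Lemma rho_continuous : continuous (@rho R n).
Proof.
move=> x; apply: (@continuous_comp _ _ _ (fun x => stretch x.1 x.2) (@ln R)).
  exact: stretch_continuous.
by apply: continuous_ln; exact: stretch_gt0.
Qed.

End Projective.

(** * Measurability and integrals *)

(** The integral of a nonnegative function is a supremum over the simple
    functions below it, so it is monotone on arbitrary functions; this lets |h| be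
    compared directly with a power of N. *)
Lemma ge0_le_integralT d (T : measurableType d) (R : realType)
    (mu : {measure set T -> \bar R}) (f1 f2 : T -> \bar R) :
  (forall x, (0 <= f1 x)%E) -> (forall x, (f1 x <= f2 x)%E) ->
  (\int[mu]_x f1 x <= \int[mu]_x f2 x)%E.
Proof.
move=> f10 f12; have f20 x : (0 <= f2 x)%E by exact: le_trans (f10 x) (f12 x).
rewrite !ge0_integralTE//; apply: ge_ereal_sup => _ [h hf1 <-].
apply: ereal_sup_ubound; exists h => //= x.
exact: le_trans (hf1 x) (f12 x).
Qed.

Lemma continuous_measurable_borel {R : realType} (T : ptopologicalType)
    (f : T -> R) :
  continuous f -> measurable_fun setT (f : borel T -> R).
Proof.
move=> /continuousP cf; apply: (measurability _ (RGenOpens.measurableE R)).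
move=> _ [_ [a [b ->] <-]]; rewrite setTI; apply: sub_sigma_algebra.
exact/cf/interval_open.
Qed.

(** * The weighted Holder space *)

(** Positive weights are essential: where w vanishes the ratio is 0 by the
    convention on division, and finiteness would say nothing about f. *)
Lemma supratio_lty {R : realType} {I : Type} (D : set I) (f : I -> R[i])
    (w : I -> R) :
  (forall i, D i -> 0 < w i) ->
  (supratio D f w < +oo)%E <->
  exists2 C, 0 <= C & forall i, D i -> Normc.normc (f i) <= C * w i.
Proof.
move=> w0; split=> [foo|[C C0 fC]].
- have ffin : supratio D f w \is a fin_num.
    by rewrite ge0_fin_numE// supratio_ge0.
  exists (fine (supratio D f w)) => [|i Di].
    by rewrite fine_ge0// supratio_ge0.
  by rewrite -ler_pdivrMr ?w0// -lee_fin fineK// supratio_ub.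
- apply: le_lt_trans (ltry C); apply: supratio_le => [|i Di].
    by rewrite lee_fin.
  by rewrite lee_fin ler_pdivrMr ?w0// fC.
Qed.

Section WeightedSpace.
Context {R : realType} {n : nat} (delta0 : R).
Hypothesis delta0_gt0 : 0 < delta0.
Implicit Types (h : stateX R n -> R[i]^o) (g : GL R n) (p q : Defs.proj R n).

Local Notation eps := (delta0 / 8).

Let eps_gt0 : 0 < eps.
Proof. by rewrite divr_gt0. Qed.

(** Finiteness of the norm of B in pointwise form, without suprema. The bounds
    are stated for all points, equal ones included. *)
Definition weighted_bounds C h :=
  [/\ forall g p, Normc.normc (h (g, p)) <= C * Nmax g `^ (3 * eps),
      forall g p q, Normc.normc (h (g, p) - h (g, q)) <=
        C * (pdist p q `^ eps * Nmax g `^ (5 * eps))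
    & forall g g' p, Normc.normc (h (g, p) - h (g', p)) <=
        C * (opnorm (GLmx g - GLmx g') `^ eps
             * Nmax g `^ (7 * eps) * Nmax g' `^ (7 * eps))].

Lemma inBP h : reflect
  (continuous h /\ exists2 C, 0 <= C & weighted_bounds C h)
  (h \in inB n delta0).
Proof.
have N0 g r : 0 < Nmax g `^ r by rewrite powR_gt0 ?Nmax_gt0.
have w1 (x : stateX R n) : setT x -> 0 < Nmax x.1 `^ (3 * eps) by [].
have w2 (z : GL R n * (Defs.proj R n * Defs.proj R n)) : z.2.1 != z.2.2 ->
    0 < pdist z.2.1 z.2.2 `^ eps * Nmax z.1 `^ (5 * eps).
  by move=> z12; rewrite mulr_gt0// powR_gt0// pdist_gt0.
have w3 (z : (GL R n * GL R n) * Defs.proj R n) : z.1.1 != z.1.2 ->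
    0 < opnorm (GLmx z.1.1 - GLmx z.1.2) `^ eps
        * Nmax z.1.1 `^ (7 * eps) * Nmax z.1.2 `^ (7 * eps).
  move=> z12; rewrite !mulr_gt0// powR_gt0// lt_neqAle opnorm_ge0 andbT.
  apply: contra z12 => /eqP/esym/opnorm_eq0/eqP.
  by rewrite subr_eq0 => /eqP gg'; apply/eqP; exact: val_inj.
have sumoo h1 : (Bnorm delta0 h1 < +oo)%E <->
    [/\ (norm_theta (3 * eps) h1 < +oo)%E, (k_proj eps (5 * eps) h1 < +oo)%E
      & (k_GL eps (7 * eps) h1 < +oo)%E].
  rewrite /Bnorm /=; split=> [|[? ? ?]]; last by rewrite !lte_add_pinfty.
  move=> Boo; split; apply: le_lt_trans Boo.
  - by rewrite -addeA leeDl// adde_ge0 ?supratio_ge0.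
  - by rewrite addeAC leeDr// adde_ge0 ?supratio_ge0.
  - by rewrite leeDr// adde_ge0 ?supratio_ge0.
apply: (iffP (asboolP _)) => -[hc]; last first.
  move=> [C C0 [h1 h2 h3]]; split => //; apply/sumoo; split.
  - by apply/(supratio_lty _ _ _ w1); exists C => // -[g p] _; exact: h1.
  - by apply/(supratio_lty _ _ _ w2); exists C => // -[g [p q]] _; exact: h2.
  - by apply/(supratio_lty _ _ _ w3); exists C => // -[[g g'] p] _; exact: h3.
move=> /sumoo[/(supratio_lty _ _ _ w1)[C1 C10 h1]
  /(supratio_lty _ _ _ w2)[C2 C20 h2] /(supratio_lty _ _ _ w3)[C3 C30 h3]].
split=> //; exists (C1 + C2 + C3); first by rewrite !addr_ge0.
split=> [g p|g p q|g g' p].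
- apply: le_trans (h1 (g, p) I) _; rewrite ler_wpM2r ?powR_ge0//.
  by rewrite -addrA lerDl addr_ge0.
- have [->|pq] := eqVneq p q.
    by rewrite subrr Normc.normc0 !mulr_ge0 ?addr_ge0 ?powR_ge0.
  apply: le_trans (h2 (g, (p, q)) pq) _.
  rewrite ler_wpM2r ?mulr_ge0 ?powR_ge0//.
  by rewrite addrAC lerDr addr_ge0.
- have [->|gg'] := eqVneq g g'.
    by rewrite subrr Normc.normc0 !mulr_ge0 ?addr_ge0 ?powR_ge0.
  apply: le_trans (h3 ((g, g'), p) gg') _.
  by rewrite ler_wpM2r ?mulr_ge0 ?powR_ge0// lerDr addr_ge0.
Qed.

Lemma Nmax_powR_le g (r s : R) : r <= s -> Nmax g `^ r <= Nmax g `^ s.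
Proof. by move=> rs; apply: ler_powR => //; exact: Nmax_ge1. Qed.

Lemma Nmax_powR_ge1 g (r : R) : 0 <= r -> 1 <= Nmax g `^ r.
Proof. by move=> r0; rewrite -[leLHS](powRr0 (Nmax g)) Nmax_powR_le. Qed.

Lemma NmaxD g (r s : R) : Nmax g `^ (r + s) = Nmax g `^ r * Nmax g `^ s.
Proof. by rewrite powRD// (gt_eqF (Nmax_gt0 g)) implybT. Qed.

Lemma cst1_inB : (fun=> 1) \in inB n delta0.
Proof.
apply/inBP; split; first exact: cst_continuous.
exists 1 => //; split=> [g p|g p q|g g' p]; rewrite mul1r.
- by rewrite Normc.normc1 Nmax_powR_ge1// mulr_ge0// ltW.
- by rewrite subrr Normc.normc0 mulr_ge0 ?powR_ge0.
- by rewrite subrr Normc.normc0 !mulr_ge0 ?powR_ge0.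
Qed.

Lemma normc_le_Bspace_norm (h : Bspace n delta0) (x : stateX R n) :
  `|h x| <= (Nmax x.1 `^ (3 * eps))%:C * `|h|.
Proof.
rewrite -[X in _ * X]/((fine (Bnorm delta0 h))%:C) -rmorphM/= -normc_normr lecR.
rewrite mulrC -ler_pdivrMr ?powR_gt0 ?Nmax_gt0// -lee_fin fine_BnormE.
rewrite /Bnorm /= -addeA; apply: le_trans (leeDl _ _).
  exact: (@supratio_ub _ _ _ (fun x => Nmax x.1 `^ _)).
by rewrite adde_ge0 ?supratio_ge0.
Qed.

Lemma eval_dual (x : stateX R n) : dual (fun h : Bspace n delta0 => h x).
Proof.
split=> [//|h]; apply/(@cvgrPdist_lt _ _ _ (nbhs h)) => e e0.
have K0 : 0 < (Nmax x.1 `^ (3 * eps))%:C :> R[i].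
  by rewrite ltcR powR_gt0 ?Nmax_gt0.
have : \forall h' \near h, `|h - h'| < e / (Nmax x.1 `^ (3 * eps))%:C.
  by apply: nbhsx_ballx; rewrite divr_gt0.
apply: (@filterS _ _ (nbhs_filter h)) => h'.
rewrite ltr_pdivlMr// mulrC; apply: le_lt_trans.
exact: (normc_le_Bspace_norm (h - h') x).
Qed.

Lemma inB_L1 (mu : probability (borel (GL R n)) R)
    (P1 : (\int[mu]_g (Nmax g `^ delta0)%:E < +oo)%E) (x : stateX R n) h :
  h \in inB n delta0 -> L1 (transition mu x) h.
Proof.
move=> /inBP[hc [C C0 [hC _ _]]].
split; first exact: continuous_borel_measurable.
have mh : measurable_fun setT
    (fun y : borel (stateX R n) => (Normc.normc (h y))%:E).
  apply/measurable_EFinP; apply: continuous_measurable_borel => y.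
  exact: (continuous_comp (hc y) (continuous_normc _)).
rewrite ge0_integral_transition//; last by move=> y; rewrite lee_fin normc_ge0.
(* The constant is moved to the measurable side before the comparison; C may
   be 0, C + 1 may not. *)
have C1 : 0 < C + 1 by rewrite ltr_wpDl.
have mhx : measurable_fun setT
    (fun g : borel (GL R n) => (Normc.normc (h (g, act x.1 x.2)))%:E).
  exact: (measurableT_comp mh (measurable_chain_step x)).
have -> : (\int[mu]_g (Normc.normc (h (g, act x.1 x.2)))%:E =
    (C + 1)%:E * \int[mu]_g
      ((C + 1)^-1%:E * (Normc.normc (h (g, act x.1 x.2)))%:E))%E.
  rewrite ge0_integralZl//; last 2 first.
  - by move=> g _; rewrite lee_fin normc_ge0.
  - by rewrite lee_fin invr_ge0 ltW.
  by rewrite muleA -EFinM divff ?mul1e// gt_eqF.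
apply: lte_mul_pinfty => //; first by rewrite lee_fin ltW.
apply: le_lt_trans P1; apply: ge0_le_integralT => g.
  by rewrite -EFinM lee_fin mulr_ge0 ?normc_ge0// invr_ge0 ltW.
rewrite -EFinM lee_fin ler_pdivrMl//; apply: le_trans (hC _ _) _.
apply: ler_pM; rewrite ?powR_ge0 ?lerDl//; apply: Nmax_powR_le.
by have := delta0_gt0; lra.
Qed.

(** The exponents add up thanks to the gaps theta + 2 eps = alpha and
    theta + eps <= beta. *)
Lemma expi_rho_inB h (t : R) : delta0 <= 8 -> `|t| <= 1 ->
  h \in inB n delta0 -> (fun x => expi (t * rho x) * h x) \in inB n delta0.
Proof.
move=> delta8 t1 /inBP[hc [C C0 [h1 h2 h3]]].
have eps1 : 0 < eps <= 1 by apply/andP; split; [exact: eps_gt0|lra].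
pose E (x : stateX R n) : R[i] := expi (t * rho x).
have ED (x y : stateX R n) (r : R) : `|rho x - rho y| <= r ->
    Normc.normc (E x - E y) <= 2 * r `^ eps.
  move=> xy; apply: le_trans (normc_dist_expi_powR eps _ _ eps1) _.
  rewrite ler_pM2l//; apply: ge0_ler_powR; rewrite ?nnegrE//.
  - exact: ltW.
  - exact: le_trans xy.
  - by rewrite -mulrBr normrM; apply: le_trans xy; rewrite ler_piMl.
have mulD (x y : stateX R n) : Normc.normc (E x * h x - E y * h y) <=
    Normc.normc (h x - h y) + Normc.normc (E x - E y) * Normc.normc (h y).
  rewrite (_ : _ - _ = E x * (h x - h y) + (E x - E y) * h y); last by ring.
  by apply: le_trans (le_normcD _ _) _; rewrite !Normc.normcM normc_expi mul1r.
have K0 : 0 <= 2 `^ eps :> R by exact: powR_ge0.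
apply/inBP; split.
  move=> x; apply: cvgM; last exact: hc.
  apply: (@continuous_comp _ _ _ (fun x => t * rho x) (@expi R : R -> R[i]^o)).
    by apply: cvgM; [exact: cvg_cst|exact: rho_continuous].
  exact: expi_continuous.
exists (C + 2 * 2 `^ eps * C + 2 * C); first by rewrite !addr_ge0 ?mulr_ge0.
split=> [g p|g p q|g g' p].
- rewrite Normc.normcM normc_expi mul1r; apply: le_trans (h1 g p) _.
  by rewrite ler_wpM2r ?powR_ge0// -addrA lerDl addr_ge0 ?mulr_ge0.
- apply: le_trans (mulD _ _) _; apply: le_trans (lerD (h2 g p q) _) _.
    by apply: ler_pM (ED _ _ _ (rho_dist_proj g p q)) (h1 g q);
      exact: normc_ge0.
  have -> : Nmax g `^ (5 * eps) =
      Nmax g `^ eps * Nmax g `^ eps * Nmax g `^ (3 * eps).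
    by rewrite -!NmaxD; congr (_ `^ _); ring.
  rewrite [(_ * pdist p q) `^ eps]powRM ?pdist_ge0 ?mulr_ge0 ?Nmax_ge0//.
  rewrite [(2 * _) `^ eps]powRM ?mulr_ge0 ?Nmax_ge0//.
  rewrite [(Nmax g * _) `^ eps]powRM ?Nmax_ge0//.
  set N := Nmax g `^ eps; set N3 := Nmax g `^ (3 * eps).
  set D := pdist p q `^ eps.
  rewrite [leLHS](_ : _ = (C + 2 * 2 `^ eps * C) * (D * (N * N * N3))); last by
    ring.
  by rewrite ler_wpM2r ?mulr_ge0 ?powR_ge0// lerDl mulr_ge0.
- apply: le_trans (mulD _ _) _; apply: le_trans (lerD (h3 g g' p) _) _.
    by apply: ler_pM (ED _ _ _ (rho_dist_GL g g' p)) (h1 g' p);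
      exact: normc_ge0.
  rewrite !powRM ?opnorm_ge0 ?mulr_ge0 ?Nmax_ge0//.
  have N7 : Nmax g `^ eps <= Nmax g `^ (7 * eps) by apply: Nmax_powR_le; lra.
  have N'7 : Nmax g' `^ eps * Nmax g' `^ (3 * eps) <= Nmax g' `^ (7 * eps).
    by rewrite -NmaxD; apply: Nmax_powR_le; lra.
  rewrite [in leRHS]mulrDl; apply: lerD.
    by rewrite ler_wpM2r ?mulr_ge0 ?powR_ge0// lerDl !mulr_ge0.
  have NN7 := ler_pM (powR_ge0 _ _)
    (mulr_ge0 (powR_ge0 _ _) (powR_ge0 _ _)) N7 N'7.
  rewrite [leLHS](_ : _ = 2 * C * (opnorm (GLmx g - GLmx g') `^ eps *
    (Nmax g `^ eps * (Nmax g' `^ eps * Nmax g' `^ (3 * eps))))); last by ring.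
  rewrite -[in leRHS]mulrA; apply: ler_wpM2l; first by rewrite mulr_ge0.
  exact: ler_wpM2l (powR_ge0 _ _) _ _ NN7.
Qed.

End WeightedSpace.

Theorem proposition0p1 (R : realType) (n : nat)
    (mu : probability (borel (GL R n)) R) (delta0 : R)
    (delta0_gt0 : 0 < delta0)
    (P1 : (\int[mu]_g (Nmax g `^ delta0)%:E < +oo)%E) :
  [/\ (fun=> 1) \in inB n delta0,
      forall x : stateX R n,
        dual (fun h : Bspace n delta0 => h x),
      forall (x : stateX R n) (h : stateX R n -> R[i]^o),
        h \in inB n delta0 -> L1 (transition mu x) h
    & delta0 <= 8 ->
      exists2 kappa : R, 0 < kappa < 1 &
        forall (h : stateX R n -> R[i]^o) (t : R),
          h \in inB n delta0 -> `|t| <= kappa ->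
          (fun x => expi (t * rho x) * h x) \in inB n delta0].
Proof.
split=> [|x|x h|delta8]; [exact: cst1_inB|exact: eval_dual|exact: inB_L1|].
exists 2^-1 => [|h t hB t2]; first by apply/andP; split; lra.
by apply: expi_rho_inB => //; lra.
Qed.
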